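(* For every $\varepsilon>0$ there is $d_0$ such that the following holds for every $d \geq d_0$. Suppose that a finite graph $G$ has an acyclic orientation $D$ such that (D1) every vertex has out-degree at most $d$ in $D$; and (D2) for every directed edge $uv$ of $D$ (directed from $u$ to $v$), there is no directed path from $u$ to $v$ of even length in $D$. Then $\chi_{DP}^\ast(G) \leq (1 + \varepsilon)d/\ln d$.
   Context: All graphs are finite, without loops or multiple edges. A cover of a graph $G$ is a pair $(L,H)$ where $H$ is a graph and $L\colon V(G)\to 2^{V(H)}$ satisfies: the sets $L(u)$, $u\in V(G)$, partition $V(H)$; each $H[L(u)]$ is complete; if there is an edge of $H$ between $L(u)$ and $L(v)$ with $u\neq v$ then $uv\in E(G)$; and for each $uv\in E(G)$ the edges of $H$ between $L(u)$ and $L(v)$ form a (not necessarily perfect, possibly empty) matching. The cover is $k$-fold if $|L(u)|=k$ for all $u$. Edges of $H$ joining different sets $L(u)\ne L(v)$ are cross-edges; $S\subseteq V(H)$ is quasi-independent if it spans no cross-edges. For $\eta\in[0,1]$, an $(\eta,(L,H))$-coloring of $G$ is a quasi-independent $S\subseteq V(H)$ with $|S\cap L(u)|\geq \eta|L(u)|$ for all $u\in V(G)$. For $k\in\mathbb{N}^+$, $\theta_{DP}(G,k)$ is the maximum $\eta\in[0,1]$ such that $G$ admits an $(\eta,\mathcal{H})$-coloring for every $k$-fold cover $\mathcal{H}$ of $G$, and $\chi_{DP}^\ast(G)=\inf\{\theta_{DP}(G,k)^{-1}: k\in\mathbb{N}^+\}$. (The paper states the conclusion as $\chi_{DP}^\ast(G)\le(1+o(1))d/\ln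 d$, with $o(1)\to0$ as $d\to\infty$ uniformly in $G$; the claim is the explicit form of this.) *)

(* Defs.v *)
From mathcomp Require Import all_boot all_order all_algebra.
From mathcomp Require Import all_classical all_reals all_analysis.

Set Implicit Arguments.
Unset Strict Implicit.
Unset Printing Implicit Defensive.

Import Order.TTheory GRing.Theory Num.Theory.

Local Open Scope ring_scope.

Record sgraph := SGraph {
  vertex :> finType;
  adj : rel vertex;
  adj_sym : symmetric adj;
  adj_irr : irreflexive adj }.

(* Some lists may be empty, unless the cover is k-fold with k > 0.
   In [cover_matching], two cross-edges between L u and L v share one end
   iff they share both. *)
Record is_cover (G H : sgraph) (L : G -> {set H}) : Prop := IsCover {
  cover_disjoint : forall u v : G, u != v -> [disjoint L u & L v];
  cover_total : forall x : H, exists u : G, x \in L u;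
  cover_complete : forall (u : G) (x y : H),
    x \in L u -> y \in L u -> x != y -> adj x y;
  cover_edge : forall (u v : G) (x y : H),
    u != v -> x \in L u -> y \in L v -> adj x y -> adj u v;
  cover_matching : forall (u v : G) (x x' y y' : H), adj u v ->
    x \in L u -> x' \in L u -> y \in L v -> y' \in L v ->
    adj x y -> adj x' y' -> (x = x' <-> y = y') }.

Definition k_fold (G H : sgraph) (L : G -> {set H}) (k : nat) : Prop :=
  forall u : G, #|L u| = k.

Definition quasi_independent (G H : sgraph) (L : G -> {set H})
    (S : {set H}) : Prop :=
  forall (u v : G) (x y : H), u != v -> x \in L u -> y \in L v ->
    x \in S -> y \in S -> ~~ adj x y.

Definition is_coloring (R : realType) (eta : R) (G H : sgraph)
    (L : G -> {set H}) (S : {set H}) : Prop :=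
  quasi_independent L S /\
  forall u : G, eta * (#|L u|)%:R <= (#|S :&: L u|)%:R.

Definition DP_colorable (R : realType) (G : sgraph) (k : nat) (eta : R) : Prop :=
  forall (H : sgraph) (L : G -> {set H}), is_cover L -> k_fold L k ->
    exists S : {set H}, is_coloring eta L S.

(* For k > 0 this supremum is attained: see [theta_DP_max] below. *)
Definition theta_DP (R : realType) (G : sgraph) (k : nat) : R :=
  sup [set eta : R | 0 <= eta <= 1 /\ DP_colorable G k eta]%classic.

(* theta_DP R G k may vanish (e.g. k = 1 and G has an edge), so its inverse is
   taken in \bar R, where 0^-1 = +oo. *)
Definition chi_DP_star (R : realType) (G : sgraph) : \bar R :=
  ereal_inf [set ((theta_DP R G k)%:E^-1)%E | k in [set k | (0 < k)%N]]%classic.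

Definition is_orientation (G : sgraph) (D : rel G) : Prop :=
  (forall u v : G, adj u v = D u v || D v u) /\
  (forall u v : G, ~~ (D u v && D v u)).

Definition acyclic (T : finType) (D : rel T) : Prop :=
  forall c : seq T, c != [::] -> ~ ucycle D c.

(* p lists the vertices after u, so that size p is the number of edges. *)
Definition dipath (T : finType) (D : rel T) (u v : T) (p : seq T) : Prop :=
  [/\ path D u p, uniq (u :: p) & last u p = v].

Definition outdeg (T : finType) (D : rel T) (u : T) : nat := #|[pred v | D u v]|.

Lemma theta_DP_max (R : realType) (G : sgraph) (k : nat) : (0 < k)%N ->
  [/\ 0 <= theta_DP R G k <= 1, DP_colorable G k (theta_DP R G k) &
      forall eta : R, 0 <= eta <= 1 -> DP_colorable G k eta ->
        eta <= theta_DP R G k].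
Proof.
move=> k_gt0; rewrite /theta_DP; set A := [set eta | _]%classic.
have A0 : A 0.
  split; first by rewrite lexx ler01.
  move=> H L _ _; exists finset.set0; split=> [u v x y _ _ _|u]; first by rewrite inE.
  by rewrite mul0r.
have supA : has_sup A.
  by split; [exists 0|exists 1 => x [/andP[_ ->]]].
have ubA : ubound A (sup A) by apply: ub_le_sup; case: supA.
have t_ge0 : 0 <= sup A by apply: ubA.
have t_le1 : sup A <= 1.
  by apply: ge_sup; [exists 0|move=> x [/andP[_ ->]]].
split; first by rewrite t_ge0.
  have [t0|t_neq0] := eqVneq (sup A) 0; first by rewrite t0; case: A0.
  have t_gt0 : 0 < sup A by rewrite lt_neqAle eq_sym t_neq0.
  move=> H L covL kL.
  pose M := \big[Num.max/0]_(j < k.+1 | j%:R / k%:R < sup A) (j%:R / k%:R : R).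
  have M_lt : 0 < sup A - M.
    rewrite subr_gt0 /M; elim/big_ind: _ => // x y xA yA.
    by rewrite gt_max xA.
  have [eta [_ colA]] := sup_adherent M_lt supA; rewrite opprB addrC subrK => Me.
  have [S [qS cS]] := colA H L covL kL; exists S; split=> // u.
  have := cS u; rewrite kL -!ler_pdivlMr ?ltr0n // => eS.
  have jk : (#|S :&: L u| < k.+1)%N by rewrite ltnS -(kL u) subset_leq_card ?subsetIr.
  rewrite leNgt; apply/negP => jt.
  have : #|S :&: L u|%:R / k%:R <= M.
    by rewrite /M; apply: (le_bigmax_cond _ (fun j : 'I_k.+1 => j%:R / k%:R) (j := Ordinal jk)).
  by move=> /(le_trans eS) /(lt_le_trans Me); rewrite ltxx.
by move=> eta eta01 col; apply: ubA.
Qed.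

(* Main.v *)
(* Orient the cross-edges of the cover along D and process the vertices of H so
   that out-neighbours come first: x enters S when its coin, of bias c(x), comes
   up and no out-neighbour of x is in S.  The biases are chosen recursively so
   that P(x in S) = q = (1 - o(1)) ln d / d exactly; this needs
   P(x is available) >= q / tau, where tau < 1 is a constant.  Now x is available
   iff no out-neighbour y both has its coin up and is available once the coins of
   all out-neighbours of x are turned off.  By (D2) every directed path between
   two out-neighbours of x is even, so turning these coins off only makes the y's
   less available.  Averaging over the coins of the out-neighbours first and then
   using Jensen's inequality gives
   P(x is available) >= exp(- d q / (1 - tau)).
   Each vertex of H shares coins with boundedly many others, in terms of G alone,
   so the second moment method gives |S :&: L u| ~ q k for all u once k is large. *)
Require Import Defs.
From mathcomp Require Import all_boot all_order all_algebra.
From mathcomp Require Import all_classical all_reals all_analysis.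
From mathcomp Require Import ring lra.

Import Order.TTheory GRing.Theory Num.Theory.

Local Open Scope ring_scope.

Set Implicit Arguments.
Unset Strict Implicit.
Unset Printing Implicit Defensive.

(** * Product Bernoulli measures *)

Section Bernoulli.
Variables (R : realType) (T : finType).
Implicit Types (c : T -> R) (w : {ffun T -> bool}) (A : pred T).

Definition bern c w : R := \prod_x (if w x then c x else 1 - c x).

Definition mean c (f : {ffun T -> bool} -> R) : R := \sum_w bern c w * f w.

Definition splice A w w' : {ffun T -> bool} :=
  [ffun x => if A x then w x else w' x].

Definition depends_on A (V : Type) (f : {ffun T -> bool} -> V) :=
  forall w w', (forall x, A x -> w x = w' x) -> f w = f w'.

Arguments depends_on A {V} f.

Lemma mean_prod c (g : T -> bool -> R) :
  mean c (fun w => \prod_x g x (w x)) =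
  \prod_x (c x * g x true + (1 - c x) * g x false).
Proof.
pose h x b := (if b then c x else 1 - c x) * g x b.
transitivity (\prod_x \sum_b h x b); last first.
  by apply: eq_bigr => x _; rewrite big_bool.
by rewrite bigA_distr_bigA; apply: eq_bigr => w _; rewrite -big_split.
Qed.

Lemma mean_cst c (a : R) : mean c (fun=> a) = a.
Proof.
have s1 : mean c (fun=> 1) = 1.
  transitivity (mean c (fun w => \prod_(x : T) 1)).
    by apply: eq_bigr => w _; rewrite big1.
  by rewrite (mean_prod c (fun _ _ => 1)) big1 // => x _; rewrite !mulr1 addrC subrK.
have -> : mean c (fun=> a) = mean c (fun=> 1) * a.
  by rewrite /mean mulr_suml; apply: eq_bigr => w _; rewrite mulr1.
by rewrite s1 mul1r.
Qed.

Lemma eq_mean c f g : f =1 g -> mean c f = mean c g.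
Proof. by move=> fg; apply: eq_bigr => w _; rewrite fg. Qed.

Lemma meanZ c a f : mean c (fun w => a * f w) = a * mean c f.
Proof. by rewrite /mean mulr_sumr; apply: eq_bigr => w _; rewrite mulrCA. Qed.

Lemma meanD c f g : mean c (fun w => f w + g w) = mean c f + mean c g.
Proof. by rewrite /mean -big_split; apply: eq_bigr => w _; rewrite mulrDr. Qed.

Lemma mean_sum c (I : Type) (r : seq I) (P : pred I) (F : I -> {ffun T -> bool} -> R) :
  mean c (fun w => \sum_(i <- r | P i) F i w) = \sum_(i <- r | P i) mean c (F i).
Proof.
rewrite /mean exchange_big; apply: eq_bigr => w _; by rewrite mulr_sumr.
Qed.

Lemma bern_ge0 c w : (forall x, 0 <= c x <= 1) -> 0 <= bern c w.
Proof.
by move=> c01; apply: prodr_ge0 => x _; have := c01 x; case: (w x); lra.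
Qed.

Lemma le_mean c f g : (forall x, 0 <= c x <= 1) ->
  (forall w, f w <= g w) -> mean c f <= mean c g.
Proof.
by move=> c01 fg; apply: ler_sum => w _; rewrite ler_wpM2l ?bern_ge0.
Qed.

Lemma mean_witness c f : (forall x, 0 <= c x <= 1) -> exists w, f w <= mean c f.
Proof.
move=> c01; case: (pselect (exists w, f w <= mean c f)) => // nex.
have W1 : \sum_w bern c w = 1.
  by rewrite -(mean_cst c 1); apply: eq_bigr => w _; rewrite mulr1.
have lt_f w : mean c f < f w by rewrite ltNge; apply/negP => ?; apply: nex; exists w.
have : 0 < \sum_w bern c w * (f w - mean c f).
  rewrite lt_neqAle sumr_ge0 ?andbT => [|w _]; last first.
    by rewrite mulr_ge0 ?bern_ge0 // subr_ge0 ltW.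
  rewrite eq_sym psumr_eq0 => [|w _]; last first.
    by rewrite mulr_ge0 ?bern_ge0 // subr_ge0 ltW.
  apply/negP => /allP W0.
  (* All differences being positive, every weight would vanish, yet the weights sum to 1. *)
  suff : \sum_w bern c w = 0 by rewrite W1 => /eqP; rewrite oner_eq0.
  rewrite big1 // => w _; have := W0 w (mem_index_enum w).
  by rewrite mulf_eq0 subr_eq0 (gt_eqF (lt_f w)) orbF => /eqP.
have -> : \sum_w bern c w * (f w - mean c f) = mean c f - mean c (fun=> mean c f).
  by rewrite /mean -sumrB; apply: eq_bigr => w _; rewrite mulrBr.
by rewrite mean_cst subrr ltxx.
Qed.

(* Exchanging the coordinates in [A] between two samples preserves their joint
   law, as long as both coins have the same bias on [A]. *)
Lemma mean_splice A c c' (F : {ffun T -> bool} -> {ffun T -> bool} -> R) :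
  (forall x, A x -> c x = c' x) ->
  mean c (fun w => mean c' (fun w' => F w w')) =
  mean c (fun w => mean c' (fun w' => F (splice A w' w) (splice A w w'))).
Proof.
move=> cc'.
have meanE G : mean c (fun w => mean c' (fun w' => G w w')) =
    \sum_(p : {ffun T -> bool} * {ffun T -> bool})
      bern c p.1 * bern c' p.2 * G p.1 p.2.
  rewrite -(pair_bigA _ (fun w w' => bern c w * bern c' w' * G w w')) /=.
  by apply: eq_bigr => w _; rewrite mulr_sumr; apply: eq_bigr => w' _; rewrite mulrA.
pose sw (p : {ffun T -> bool} * {ffun T -> bool}) :=
  (splice A p.2 p.1, splice A p.1 p.2).
have swK : involutive sw.
  have spliceK u v : splice A (splice A u v) (splice A v u) = u.
    by apply/ffunP => x; rewrite !ffunE; case: ifP => Ax; rewrite Ax.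
  by case=> w w'; rewrite /sw /= !spliceK.
rewrite !meanE (reindex_inj (inv_inj swK)) /=; apply: eq_bigr => -[w w'] _ /=.
congr (_ * _); rewrite /bern -!big_split; apply: eq_bigr => x _ /=.
by rewrite !ffunE; case Ax: (A x); rewrite ?Ax // cc' // mulrC.
Qed.

Arguments mean_splice A {c c'} F.

(** The product of the means is a mean over two independent samples; exchanging their coordinates in
    [A] makes [f] and [g] read the same sample. *)
Lemma mean_indep A B c (f g : _ -> R) : depends_on A f -> depends_on B g ->
  (forall x, A x -> ~~ B x) -> mean c (fun w => f w * g w) = mean c f * mean c g.
Proof.
move=> fA gB dAB; apply/esym.
transitivity (mean c (fun w => mean c (fun w' => f w * g w'))).
  rewrite mulrC -meanZ; apply: eq_mean => w.
  by rewrite meanZ mulrC.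
rewrite (mean_splice A) //.
transitivity (mean c (fun w => mean c (fun w' => f w' * g w'))).
  apply: eq_mean => w; apply: eq_mean => w'; congr (_ * _).
    by apply: fA => x Ax; rewrite ffunE Ax.
  by apply: gB => x Bx; rewrite ffunE; case: ifP => // /dAB; rewrite Bx.
by rewrite mean_cst.
Qed.

Lemma eq_mean_bias A c c' (f : _ -> R) : depends_on A f -> (forall x, A x -> c x = c' x) ->
  mean c f = mean c' f.
Proof.
move=> fA cc'.
transitivity (mean c (fun w => mean c' (fun=> f w))).
  by apply: eq_mean => w; rewrite mean_cst.
rewrite (mean_splice A) //.
transitivity (mean c (fun w => mean c' f)); last by rewrite mean_cst.
apply: eq_mean => w; apply: eq_mean => w'.
by apply: fA => x Ax; rewrite ffunE Ax.
Qed.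

(* The coins in [A] are averaged first, conditionally on those outside [A]. *)
Lemma mean_prod_cond A c (b : T -> {ffun T -> bool} -> bool) :
  (forall y, depends_on (predC A) (b y)) ->
  mean c (fun w => \prod_(y | A y) (1 - (w y && b y w)%:R)) =
  mean c (fun w => \prod_(y | A y) (1 - c y * (b y w)%:R)).
Proof.
move=> bA.
pose f w : R := \prod_(y | A y) (1 - (w y && b y w)%:R).
transitivity (mean c (fun w => mean c (fun=> f w))).
  by apply: eq_mean => w; rewrite mean_cst.
rewrite (mean_splice A) //; apply: eq_mean => w.
pose g y v := if A y then 1 - (v && b y w)%:R else 1 : R.
transitivity (mean c (fun w' => \prod_y g y (w' y))).
  apply: eq_mean => w'; rewrite /f big_mkcond; apply: eq_bigr => y _.
  rewrite /g; case: ifP => // Ay; rewrite ffunE Ay.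
  rewrite (bA y _ w) // => x /negbTE nAx; by rewrite ffunE nAx.
rewrite mean_prod [RHS]big_mkcond; apply: eq_bigr => y _.
rewrite /g; case: ifP => _; case: (b y w) => /=; ring.
Qed.

End Bernoulli.

(** * The greedy random set *)

Section Greedy.
Variables (R : realType) (T : finType) (E : rel T) (rk : T -> nat).
Hypothesis rkE : forall x y, E x y -> (rk y < rk x)%N.
Implicit Types (c : T -> R) (w : {ffun T -> bool}).

(** The first argument is fuel. Ranks drop along arcs, so with fuel [(rk x).+1] the default value at
    fuel 0 is never consulted. *)
Fixpoint greedy_rec n w x : bool :=
  if n is m.+1 then w x && [forall y, E x y ==> ~~ greedy_rec m w y] else false.

Definition greedy w x := greedy_rec (rk x).+1 w x.

Definition avail w x := [forall y, E x y ==> ~~ greedy w y].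

Lemma greedyE w x : greedy w x = w x && avail w x.
Proof.
have stable n m y : (rk y < n)%N -> (rk y < m)%N -> greedy_rec n w y = greedy_rec m w y.
  elim: n m y => [|n IHn] [|m] y //= yn ym; congr (_ && _).
  apply: eq_forallb => z; case Eyz: (E y z) => //=; congr (~~ _).
  by apply: IHn; apply: leq_trans (rkE Eyz) _.
rewrite /greedy /=; congr (_ && _); apply: eq_forallb => y.
case Exy: (E x y) => //=; congr (~~ _); apply: stable => //; exact: rkE.
Qed.

Lemma rank_ind (P : T -> Prop) :
  (forall x, (forall y, E x y -> P y) -> P x) -> forall x, P x.
Proof.
move=> IH x; have [n] := ubnP (rk x); elim: n x => // n IHn x xn.
by apply: IH => y /rkE yx; apply: IHn; apply: leq_trans yx _.
Qed.

Lemma eq_avail w w' x : (forall y, E x y -> greedy w y = greedy w' y) ->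
  avail w x = avail w' x.
Proof. by move=> eq_xy; apply: eq_forallb => y; have [/eq_xy->|] := boolP (E x y). Qed.

Lemma greedy_depends x : depends_on (connect E x) (greedy^~ x).
Proof.
elim/rank_ind: x => x IH w w' ww' /=; rewrite !greedyE ww' ?connect0 //.
congr (_ && _); apply: eq_avail => y Exy; apply: IH => // z yz.
by apply: ww'; apply: connect_trans (connect1 Exy) yz.
Qed.

Lemma connect_rank x y : connect E x y -> (rk y <= rk x)%N.
Proof.
case/connectP => p + ->; elim: p x => //= y' p IHp x /andP[Exy /IHp].
by move/leq_trans; apply; apply/ltnW/rkE.
Qed.

(** Availability ignores the coin of [x] and all coins of its rank or above, so it is settled before
    the bias of [x] is chosen. *)
Lemma avail_depends x : depends_on (fun z => (rk z < rk x)%N) (avail^~ x).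
Proof.
move=> w w' ww'; apply: eq_avail => y Exy; apply: greedy_depends => z /connect_rank yz.
by apply: ww'; apply: leq_ltn_trans yz (rkE Exy).
Qed.

Lemma greedy_depends_rank x : depends_on (fun z => (rk z <= rk x)%N) (greedy^~ x).
Proof. by move=> w w' ww'; apply: greedy_depends => z /connect_rank; apply: ww'. Qed.

(** The coin of [x] is independent of its availability: this is the one-factor case of
    [mean_prod_cond], with the constant 1 cancelled. *)
Lemma mean_greedy c x :
  mean c (fun w => (greedy w x)%:R) = c x * mean c (fun w => (avail w x)%:R).
Proof.
have := @mean_prod_cond R T (pred1 x) c (fun y w => (y == x) && avail w x).
have dep y : depends_on (predC (pred1 x)) (fun w => (y == x) && avail w x).
  move=> w w' ww'; congr (_ && _); apply: avail_depends => z zx.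
  by apply: ww'; apply/eqP => zE; rewrite zE ltnn in zx.
move=> /(_ dep); under eq_mean do rewrite big_pred1_eq eqxx /= -greedyE -mulN1r.
under [RHS]eq_mean do rewrite big_pred1_eq eqxx /= -mulNr.
by rewrite !meanD !meanZ mean_cst => /addrI; rewrite mulN1r mulNr => /oppr_inj.
Qed.

Section Kill.
Variable x : T.

Definition kill w : {ffun T -> bool} := [ffun z => ~~ E x z && w z].

Lemma kill_depends y : depends_on (predC (E x)) (fun w => avail (kill w) y).
Proof.
move=> w w' ww'; congr (avail _ y); apply/ffunP => z; rewrite !ffunE.
by have [//|/ww' ->] := boolP (E x z).
Qed.

(** Either side of the equation implies, by induction along arcs, that killing leaves the greedy set
    unchanged; then the two sides are the same test. *)
Lemma avail_kill w : avail w x = [forall y, E x y ==> ~~ (w y && avail (kill w) y)].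
Proof.
have killE : (forall y, E x y -> ~~ greedy w y) \/
    (forall y, E x y -> ~~ (w y && avail (kill w) y)) ->
    forall z, greedy w z = greedy (kill w) z.
  move=> H; elim/rank_ind=> z /eq_avail IH.
  rewrite [RHS]greedyE ffunE; have [Exz|nExz] /= := boolP (E x z); last first.
    by rewrite greedyE IH.
  case: H => H; first exact/negbTE/H.
  by rewrite greedyE IH; apply/negbTE/H.
apply/forall_inP/forall_inP => H y Exy; have := H y Exy.
  have eqk := killE (or_introl H).
  by rewrite greedyE (eq_avail (fun z _ => eqk z)).
have eqk := killE (or_intror H).
by rewrite greedyE (eq_avail (fun z _ => eqk z)).
Qed.

Hypothesis parity : forall y p, E x y -> path E y p -> E x (last y p) -> ~~ odd (size p).

(* A coin at the end of an even walk acts monotonically, hence removing the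
   coins of the out-neighbours of [x] can only make these less available. *)
Lemma kill_avail w y : E x y -> avail (kill w) y -> avail w y.
Proof.
pose par b z := forall p, path E z p -> E x (last z p) -> odd (size p) = b.
(* At even parity killing can only remove [z], at odd parity only add it. Parity flips along each
   arc, so the two claims are proved jointly. *)
have mono z : (par false z -> greedy (kill w) z -> greedy w z) /\
              (par true z -> greedy w z -> greedy (kill w) z).
  elim/rank_ind: z => z IH; have parS b z' : E z z' -> par b z -> par (~~ b) z'.
    move=> Ezz' zb p pz lp; have := zb (z' :: p); rewrite /= Ezz' => /(_ pz lp) <-.
    by rewrite negbK.
  rewrite !greedyE ffunE; split=> zb.
    case/andP=> /andP[_ ->] /forall_inP av; apply/forall_inP => z' Ezz'.
    by apply: contra (av z' Ezz'); apply: (IH z' Ezz').2; apply: parS zb.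
  case/andP=> -> /forall_inP av; rewrite andbT; apply/andP; split.
    (* The empty walk is even, so a vertex of odd parity is not an out-neighbour of [x] and keeps
       its coin. *)
    by apply/negP => Exz; have := zb [::] isT Exz.
  apply/forall_inP => z' Ezz'.
  by apply: contra (av z' Ezz'); apply: (IH z' Ezz').1; apply: parS zb.
move=> Exy /forall_inP av; apply/forall_inP => z Eyz.
apply: contra (av z Eyz); apply: (mono z).2 => p pz lp.
have := parity (p := z :: p) Exy; rewrite /= Eyz => /(_ pz lp).
by rewrite negbK.
Qed.

Lemma mean_avail_ge c (q tau d : R) : (forall y, 0 <= c y <= tau) -> tau < 1 ->
  0 <= q -> #|E x|%:R <= d ->
  (forall y, E x y -> mean c (fun w => (greedy w y)%:R) = q) ->
  expR (- (d * q / (1 - tau))) <= mean c (fun w => (avail w x)%:R).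
Proof.
move=> c01 tau1 q0 dE Sq; set m := d * q / _.
have t1 : 0 < 1 - tau by rewrite subr_gt0.
have c1 y : 0 <= c y <= 1 by have := c01 y; lra.
pose Z w := \sum_(y | E x y) c y / (1 - tau) * (avail (kill w) y)%:R.
have -> : mean c (fun w => (avail w x)%:R) =
    mean c (fun w => \prod_(y | E x y) (1 - (w y && avail (kill w) y)%:R)).
  apply: eq_mean => w; have := avail_kill w.
  have [_ /esym/forall_inP av|_ /esym/negbT] := boolP (avail w x).
    by rewrite big1 // => y /av /negbTE ->; rewrite subr0.
  rewrite negb_forall => /existsP[y]; rewrite negb_imply negbK => /andP[Exy wy].
  by rewrite (bigD1 y) //= wy subrr mul0r.
rewrite mean_prod_cond; last exact: kill_depends.
(* By [kill_avail], [c y] times the probability that [y] is available after killing is at most the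
   probability that [y] is in the greedy set, which is [q]. *)
have Zm : mean c Z <= m.
  rewrite /Z mean_sum.
  apply: (@le_trans _ _ (\sum_(y | E x y) q / (1 - tau))); last first.
    by rewrite sumr_const -mulr_natl /m -mulrA ler_wpM2r // divr_ge0 // ltW.
  apply: ler_sum => y Exy; rewrite meanZ mulrAC ler_pM2r ?invr_gt0 //.
  rewrite -(Sq y Exy) mean_greedy ler_wpM2l //; first by case/andP: (c01 y).
  apply: le_mean => // w; rewrite ler_nat.
  by have := kill_avail (w := w) Exy; case: avail => // ->.
(* Jensen's inequality by hand: the integrand is the tangent at [m] of the convex function exp(-z),
   evaluated at [Z w]. *)
apply: (@le_trans _ _ (mean c (fun w => expR (- m) * (1 + m) + - expR (-m) * Z w))).
  rewrite meanD !meanZ mean_cst mulNr -mulrBr -[leLHS]mulr1 ler_pM2l ?expR_gt0 //.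
  lra.
apply: le_mean => // w; apply: (@le_trans _ _ (expR (- Z w))).
  have -> : - Z w = - m + (m - Z w) by ring.
  rewrite expRD mulNr -mulrBr ler_pM2l ?expR_gt0 // -addrA; exact: expR_ge1Dx.
rewrite -sumrN expR_sum; apply: ler_prod => y _; rewrite expR_ge0 /=.
case: avail; rewrite ?mulr0 ?oppr0 ?expR0 ?addr0 ?mulr1 //.
have /andP[cy0 cyt] := c01 y.
have u0 : 0 < 1 - c y by lra.
(* Inverted, this is 1 - c >= exp(-c / (1 - tau)), the bound on each surviving factor. *)
have le1 : (1 - c y)^-1 <= expR (c y / (1 - tau)).
  apply: le_trans (expR_ge1Dx _); have -> : (1 - c y)^-1 = 1 + c y / (1 - c y).
    by field; rewrite lt0r_neq0.
  by rewrite lerD2l ler_wpM2l // lef_pV2 ?posrE //; lra.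
by rewrite expRN -[leRHS]invrK lef_pV2 ?posrE ?invr_gt0 ?expR_gt0.
Qed.

End Kill.

Lemma greedy_bias (q tau d : R) :
  (forall x y p, E x y -> path E y p -> E x (last y p) -> ~~ odd (size p)) ->
  (forall x, #|E x|%:R <= d) -> 0 <= q -> tau < 1 ->
  q <= tau * expR (- (d * q / (1 - tau))) ->
  exists c, (forall x, 0 <= c x <= tau) /\
    forall x, mean c (fun w => (greedy w x)%:R) = q.
Proof.
move=> parity dE q0 tau1 qtau.
have tau0 : 0 <= tau by have := le_trans q0 qtau; rewrite pmulr_lge0 ?expR_gt0.
suff /(_ (\max_x rk x).+1) [c [c01 cq]] : forall n, exists c,
    (forall x, 0 <= c x <= tau) /\
    forall x, (rk x < n)%N -> mean c (fun w => (greedy w x)%:R) = q.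
  by exists c; split=> // x; apply: cq; rewrite ltnS; apply: leq_bigmax.
elim=> [|n [c [c01 cq]]]; first by exists (fun=> 0); split=> // x; rewrite lexx.
pose av x := mean c (fun w => (avail w x)%:R).
(* This bias makes the probability of [x] exactly [q]. The lower bound on [av x] keeps it at most
   [tau], and events of lower rank do not see the change. *)
pose c' x := if rk x == n then q / av x else c x.
have av_ge x : rk x = n -> expR (- (d * q / (1 - tau))) <= av x.
  move=> xn; apply: mean_avail_ge => //; first exact: parity.
  by move=> y /rkE; rewrite xn; apply: cq.
have av_gt0 x : rk x = n -> 0 < av x.
  by move/av_ge; apply: lt_le_trans; rewrite expR_gt0.
exists c'; split=> x; rewrite /c'.
  case: eqP => [xn|_ //]; rewrite divr_ge0 ?(ltW (av_gt0 x xn)) //=.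
  rewrite ler_pdivrMr ?av_gt0 //; apply: le_trans qtau _.
  by rewrite ler_wpM2l // av_ge.
rewrite ltnS leq_eqVlt => /predU1P[xn|xn].
  rewrite mean_greedy /c' xn eqxx.
  suff -> : mean c' (fun w => (avail w x)%:R) = av x by rewrite divfK // gt_eqF ?av_gt0.
  apply: (@eq_mean_bias _ _ (fun z => (rk z < rk x)%N)).
    by move=> w w' /avail_depends ->.
  by move=> z zx; rewrite /c' ltn_eqF // -xn.
rewrite -(cq x xn); apply: (@eq_mean_bias _ _ (fun z => (rk z <= rk x)%N)).
  by move=> w w' /greedy_depends_rank ->.
by move=> z zx; rewrite /c' ltn_eqF // (leq_ltn_trans zx).
Qed.

End Greedy.

(** * Concentration *)

(** Expand the square: centred variables with disjoint domains are independent and contribute 0,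
    every other pair at most 1, and each [x] meets at most [M] domains. *)
Lemma second_moment (R : realType) (T : finType) (c : T -> R) (q : R) (P : {set T})
    (X : T -> {ffun T -> bool} -> bool) (dom : T -> pred T) (M : nat) :
  (forall x, 0 <= c x <= 1) -> 0 <= q <= 1 ->
  (forall x, depends_on (dom x) (X x)) ->
  (forall x, mean c (fun w => (X x w)%:R) = q) ->
  (forall x, (#|[pred y | ~~ [disjoint dom x & dom y]]| <= M)%N) ->
  mean c (fun w => (\sum_(x in P) ((X x w)%:R - q)) ^+ 2) <= (#|P| * M)%:R.
Proof.
move=> c01 q01 Xdom Xq domM; pose Y x w : R := (X x w)%:R - q.
have Ydom x : depends_on (dom x) (Y x) by move=> w w' /Xdom; rewrite /Y => ->.
have Y1 x w : `|Y x w| <= 1 by rewrite /Y ler_norml; case: (X x w) => /=; lra.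
have YY x y : mean c (fun w => Y x w * Y y w) <= (~~ [disjoint dom x & dom y])%:R.
  have [dxy|_] := boolP [disjoint dom x & dom y]; last first.
    rewrite -[leRHS](mean_cst c); apply: le_mean => // w /=.
    by apply: le_trans (ler_norm _) _; rewrite normrM mulr_ile1.
  rewrite (mean_indep (A := dom x) (B := dom y)) //.
    by rewrite meanD mean_cst Xq subrr mul0r.
  by move=> z zx; rewrite -[dom y z]/(z \in dom y) (disjointFr dxy).
under eq_mean do rewrite expr2 big_distrlr /=.
rewrite mean_sum natrM mulr_natl -sumr_const; apply: ler_sum => x _.
rewrite mean_sum; apply: (@le_trans _ _ (\sum_(y in P) (~~ [disjoint dom x & dom y])%:R)).
  by apply: ler_sum => y _; apply: YY.
rewrite -natr_sum ler_nat; apply: leq_trans (domM x).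
rewrite -sum1_card [leqRHS]big_mkcond /= [leqLHS]big_mkcond; apply: leq_sum => y _.
by rewrite inE; case: ifP => //; case: disjoint.
Qed.

(** * Counting the vertices that share coins *)

Section Reach.
Variables (T : finType) (N : rel T).

(** Walks of exactly [n] steps; when [N] is reflexive, these account for shorter walks too. *)
Fixpoint reach n x y : bool :=
  if n is m.+1 then [exists z, N x z && reach m z y] else x == y.

Lemma reach_step n x y z : N x y -> reach n y z -> reach n.+1 x z.
Proof. by move=> xy yz; apply/existsP; exists y; rewrite xy. Qed.

Lemma reach_cat m n x y z : reach m x y -> reach n y z -> reach (m + n) x z.
Proof.
elim: m x => [x /eqP-> //|m IHm x /existsP[t /andP[Nxt /IHm tz]] /tz].
by move=> tz'; apply/existsP; exists t; rewrite Nxt.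
Qed.

Lemma reach_sym n x y : symmetric N -> reach n x y -> reach n y x.
Proof.
move=> symN; elim: n x => [x|n IHn x /existsP[z /andP[Nxz /IHn yz]]]; first by rewrite /= eq_sym.
rewrite -addn1; apply: reach_cat yz _; apply/existsP; exists x.
by rewrite symN Nxz /=.
Qed.

Lemma reach_leq m n x y : reflexive N -> (m <= n)%N -> reach m x y -> reach n x y.
Proof.
move=> reflN mn xy; rewrite -(subnK mn); apply: reach_cat xy.
by elim: (n - m)%N => //= k xx; apply/existsP; exists x; rewrite reflN.
Qed.

Lemma card_reach K n x : (forall y, #|N y| <= K)%N -> (#|reach n x| <= K ^ n)%N.
Proof.
move=> NK; elim: n x => [|n IHn] x.
  by rewrite (eq_card (B := pred1 x)) ?card1 // => y; rewrite !inE eq_sym.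
apply: (@leq_trans (\sum_(z | N x z) #|reach n z|)); last first.
  rewrite expnS; apply: leq_trans (leq_mul (NK x) (leqnn _)).
  by rewrite -sum_nat_const; apply: leq_sum => z _; apply: IHn.
under eq_bigr do rewrite -sum1_card big_mkcond.
rewrite exchange_big -sum1_card big_mkcond; apply: leq_sum => y _.
case: ifP => // /existsP[z /andP[Nxz zy]].
by rewrite (bigD1 z) //= [y \in _]zy.
Qed.

End Reach.

(** If the two reachable sets meet in [z], then going from [x] to [z] and back up to [y] takes at
    most [n + n] steps in the symmetric reflexive closure of [E], whose degrees are at most [K]. *)
Lemma card_connect_meet (T : finType) (E : rel T) (rk : T -> nat) (n K : nat) :
  (forall x y, E x y -> (rk y < rk x)%N) -> (forall x, rk x <= n)%N ->
  (forall x, #|[pred y | [|| x == y, E x y | E y x]]| <= K)%N ->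
  forall x, (#|[pred y | ~~ [disjoint connect E x & connect E y]]| <= K ^ (n + n))%N.
Proof.
move=> rkE rkn NK x; pose N := [rel x y | [|| x == y, E x y | E y x]].
have symN : symmetric N by move=> y z /=; rewrite eq_sym [E y z || _]orbC.
have reflN : reflexive N by move=> y; rewrite /= eqxx.
have reachE y z : connect E y z -> reach N n y z.
  move=> /connectP[p yp ->]; apply: (@reach_leq _ _ (rk y)) => //.
  elim: p y yp => [y _|t p IHp y /andP[Eyt /IHp tz]].
    by apply: (@reach_leq _ _ 0) => //=; apply: eqxx.
  apply: (@reach_leq _ _ (rk t).+1) => //; first exact: rkE.
  by apply: reach_step tz; rewrite /= Eyt orbT.
apply: leq_trans (card_reach (N := N) (n + n) x NK).
apply: subset_leq_card; apply/fintype.subsetP => y; rewrite inE => /pred0Pn[z /= /andP[xz yz]].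
apply: (reach_cat (reachE _ _ xz)); apply: reach_sym => //; exact: reachE yz.
Qed.

(** The rank counts reachable vertices. It drops strictly along [D x y], since a path from [y] back
    to [x], once shortened, would close up to a cycle. *)
Lemma acyclic_rank (T : finType) (D : rel T) : acyclic D ->
  exists2 rk : T -> nat, (forall x y, D x y -> (rk y < rk x)%N) &
    forall x, (rk x <= #|T|)%N.
Proof.
move=> acD; exists (fun x => #|connect D x|); last by move=> x; apply: max_card.
move=> x y Dxy; apply: proper_card; apply/properP; split.
  by apply/fintype.subsetP => z; apply: connect_trans (connect1 Dxy).
exists x; first exact: connect0.
apply/negP => /connectP[p yp xE]; case/shortenP: yp xE => p' yp' up' _ xE.
apply: (acD (y :: p')) => //; apply/andP; split=> //.
by rewrite /= rcons_path yp' -xE.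
Qed.

(** * Orienting the cross-edges of a cover *)

Section Cover.
Variables (G H : sgraph) (L : G -> {set H}) (D : rel G) (rk : G -> nat).
Hypotheses (covL : is_cover L) (oriD : is_orientation D).
Hypothesis rkD : forall u v, D u v -> (rk v < rk u)%N.

Definition base x : G := xchoose (cover_total covL x).

Definition arc : rel H := [rel x y | adj x y && D (base x) (base y)].

Lemma mem_base x : x \in L (base x).
Proof. exact: (xchooseP (cover_total covL x)). Qed.

Lemma base_eq u x : x \in L u -> base x = u.
Proof.
move=> xu; apply/eqP; apply: contraTT xu => bu.
by rewrite (disjointFr (cover_disjoint covL bu)) ?mem_base.
Qed.

Lemma arc_rank x y : arc x y -> (rk (base y) < rk (base x))%N.
Proof. by case/andP=> _ /rkD. Qed.

Lemma adj_base_inj x y y' : adj (base x) (base y) -> base y = base y' ->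
  adj x y -> adj x y' -> y = y'.
Proof.
move=> xy yy' axy axy'; apply/(cover_matching covL xy _ _ _ _ axy axy') => //;
  rewrite ?mem_base //; rewrite yy'; exact: mem_base.
Qed.

(** The matching condition makes [base] injective on out-neighbours, so (D1) lifts to the cover. *)
Lemma card_arc x : (#|arc x| <= outdeg D (base x))%N.
Proof.
have inj : {in arc x &, injective base}.
  move=> y y' /andP[axy Dxy] /andP[axy' Dxy'] yy'; apply: adj_base_inj axy axy' => //.
  by rewrite oriD.1 Dxy.
rewrite -(card_in_image inj); apply: subset_leq_card; apply/fintype.subsetP => v.
by case/fintype.imageP=> y /andP[_ Dxy] ->.
Qed.

(** Closed neighbourhoods also inject into [G]. The bound does not involve the cover, which lets the
    fold number be chosen after it. *)
Lemma card_arc_near x : (#|[pred y | [|| x == y, arc x y | arc y x]]| <= #|G|)%N.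
Proof.
have nearP y : [|| x == y, arc x y | arc y x] ->
    x = y \/ adj x y /\ adj (base x) (base y).
  case/or3P=> [/eqP->|/andP[axy Dxy]|/andP[ayx Dyx]]; first by left.
    by right; rewrite oriD.1 Dxy.
  by right; rewrite adj_sym oriD.1 Dyx orbT.
have inj : {in [pred y | [|| x == y, arc x y | arc y x]] &, injective base}.
  move=> y y' /nearP[<-|[axy Gxy]] /nearP[<-|[axy' Gxy']] // yy'.
  - by rewrite -yy' adj_irr in Gxy'.
  - by rewrite yy' adj_irr in Gxy.
  - exact: adj_base_inj axy axy'.
by rewrite -(card_in_image inj) max_card.
Qed.

Lemma path_base x p : path arc x p -> path D (base x) (map base p).
Proof. by elim: p x => //= y p IHp x /andP[/andP[_ ->] /IHp]. Qed.

Lemma path_rank_uniq u p : path D u p -> uniq (u :: p).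
Proof.
move=> up; apply: (@sorted_uniq _ (relpre rk gtn)) => [v w t /= vw|v|].
- by move/ltn_trans; apply.
- by rewrite /= ltnn.
- by apply: (sub_path _ up) => v w; apply: rkD.
Qed.

(** An arc followed by an odd walk projects to a directed walk of even length in [D]; ranks drop
    along it, so it is a path, and the arc from [x] to its end contradicts (D2). *)
Lemma arc_parity :
  (forall u v : G, D u v -> ~ exists p : seq G, dipath D u v p /\ ~~ odd (size p)) ->
  forall x y p, arc x y -> path arc y p -> arc x (last y p) -> ~~ odd (size p).
Proof.
move=> noeven x y p xy yp /andP[_ Dxl]; apply/negP => oddp.
apply: (noeven _ _ Dxl); exists (map base (y :: p)); split; last first.
  by rewrite size_map /= negbK.
have xyp : path D (base x) (map base (y :: p)) by apply: path_base; rewrite /= xy.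
by split=> //; [exact: path_rank_uniq|rewrite /= last_map].
Qed.

Lemma greedy_quasi_independent (w : {ffun H -> bool}) :
  quasi_independent L (finset (greedy arc (rk \o base) w)).
Proof.
have greedy_arc x y : greedy arc (rk \o base) w x -> greedy arc (rk \o base) w y ->
    ~~ arc x y.
  rewrite greedyE; last exact: arc_rank.
  by move=> /andP[_ /forallP/(_ y)] + wy; rewrite wy implybF.
move=> u v x y uv xu yv; rewrite !inE => wx wy; apply/negP => axy.
have Guv := cover_edge covL uv xu yv axy.
have := greedy_arc x y wx wy; have := greedy_arc y x wy wx.
rewrite /arc /= [adj y x]adj_sym axy (base_eq xu) (base_eq yv) /=.
by move: Guv; rewrite oriD.1 => /orP[] ->.
Qed.

End Cover.

Lemma DP_colorable_lt (R : realType) (q tau d eta : R) (G : sgraph) (D : rel G) :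
  is_orientation D -> acyclic D -> (forall u : G, (outdeg D u)%:R <= d) ->
  (forall u v : G, D u v -> ~ exists p : seq G, dipath D u v p /\ ~~ odd (size p)) ->
  0 <= eta -> eta < q -> q <= 1 -> tau < 1 ->
  q <= tau * expR (- (d * q / (1 - tau))) ->
  exists2 k, (0 < k)%N & DP_colorable G k eta.
Proof.
move=> oriD /acyclic_rank[rk rkD rkG] degD noeven eta0 etaq q1 tau1 qtau.
pose M := (#|G| ^ (#|G| + #|G|))%N.
have dq2 : 0 < (q - eta) ^+ 2 by rewrite exprn_gt0 // subr_gt0.
(* [k] above [B] makes the total variance, at most [#|G| * (k * M)], no larger than the squared
   slack [((q - eta) * k) ^+ 2]. *)
pose B : R := (#|G| * M)%:R / (q - eta) ^+ 2.
have B0 : 0 <= B by rewrite divr_ge0 ?ler0n // ltW.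
have Bk := archi_boundP B0; set k := Num.Def.archi_bound B in Bk.
have k0 : (0 < k)%N by rewrite -(ltr_nat R); apply: le_lt_trans Bk.
exists k => // H L covL kL.
have rkE := arc_rank (covL := covL) rkD.
have degE x : #|arc D covL x|%:R <= d.
  by apply: le_trans (degD (base covL x)); rewrite ler_nat card_arc.
have [c [c01 cq]] := greedy_bias rkE (arc_parity rkD noeven) degE
  (ltW (le_lt_trans eta0 etaq)) tau1 qtau.
have c1 x : 0 <= c x <= 1 by have := c01 x; lra.
have q01 : 0 <= q <= 1 by lra.
pose X x w := greedy (arc D covL) (rk \o base covL) w x.
have Var u : mean c (fun w => (\sum_(x in L u) ((X x w)%:R - q)) ^+ 2) <= (k * M)%:R.
  rewrite -(kL u); apply: (@second_moment _ _ _ _ _ X (connect (arc D covL))) => //.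
    by move=> x; apply: greedy_depends.
  apply: (card_connect_meet rkE) => [x|x]; first exact: rkG.
  exact: card_arc_near.
(* Summing the squared deviations over all [u] yields one outcome that is good for every list at
   once. *)
have [w] := mean_witness (fun w => \sum_u (\sum_(x in L u) ((X x w)%:R - q)) ^+ 2) c1.
rewrite mean_sum => Sw; exists (finset (greedy (arc D covL) (rk \o base covL) w)).
split=> [|u]; first exact: greedy_quasi_independent.
have Xu : (\sum_(x in L u) ((X x w)%:R - q)) ^+ 2 <= ((q - eta) * k%:R) ^+ 2.
  apply: (@le_trans _ _ (#|G|%:R * (k * M)%:R)).
    apply: (@le_trans _ _ (\sum_u (\sum_(x in L u) ((X x w)%:R - q)) ^+ 2)).
      by rewrite (bigD1 u) //= lerDl sumr_ge0 // => v _; rewrite sqr_ge0.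
    apply: le_trans Sw _; apply: le_trans (ler_sum _ (fun v _ => Var v)) _.
    by rewrite sumr_const mulr_natl.
  have := ltW Bk; rewrite /B ler_pdivrMr // exprMn !natrM => /(ler_wpM2r (ler0n R k)).
  lra.
have cardE : (#|finset (greedy (arc D covL) (rk \o base covL) w) :&: L u|)%:R =
    \sum_(x in L u) ((X x w)%:R - q) + q * k%:R :> R.
  rewrite sumrB sumr_const kL -[q *+ k]mulr_natr subrK -natr_sum -sum1_card; congr _%:R.
  rewrite big_mkcond [RHS]big_mkcond; apply: eq_bigr => x _.
  by rewrite !inE /X; case: (x \in L u); case: (greedy _ _ _ x).
rewrite cardE kL; set s := \sum_(_ in _) _ in Xu *.
have : - ((q - eta) * k%:R) <= s.
  have : 0 <= (q - eta) * k%:R by rewrite mulr_ge0 ?subr_ge0 // ltW.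
  nra.
lra.
Qed.

(** * Choice of the parameters *)

Lemma le_ln_expR (R : realType) (a b L : R) : 0 < a -> 0 < b ->
  4 * b / a ^+ 2 <= L -> b * L <= expR (a * L).
Proof.
move=> a0 b0 bL; have L0 : 0 <= L.
  by apply: le_trans bL; rewrite divr_ge0 ?mulr_ge0 ?exprn_ge0 // ltW.
(* Squaring exp(y) >= y at y = a L / 2 gives a quadratic lower bound, which exceeds b L once L
   reaches the threshold. *)
have le_sq : (a * L / 2) ^+ 2 <= expR (a * L).
  have -> : expR (a * L) = expR (a * L / 2) ^+ 2.
    by rewrite -expRM_natl; congr expR; field.
  have y0 : 0 <= a * L / 2 by rewrite divr_ge0 ?mulr_ge0 // ltW.
  by rewrite ler_sqr ?nnegrE ?expR_ge0 //; have := expR_ge1Dx (a * L / 2); lra.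
apply: le_trans le_sq; rewrite ler_pdivrMr ?exprn_gt0 // in bL.
have -> : (a * L / 2) ^+ 2 = L * a ^+ 2 * L / 4 by field.
by rewrite ler_pdivlMr // mulrAC ler_wpM2r //; lra.
Qed.

Unset Implicit Arguments.

Theorem theorem1p8 (R : realType) (eps : R) (eps_gt0 : 0 < eps) :
  exists d0 : R, forall d : R, d0 <= d ->
  forall (G : sgraph) (D : rel G),
    is_orientation D -> acyclic D ->
    (forall u : G, (outdeg D u)%:R <= d) ->
    (forall u v : G, D u v ->
       ~ exists p : seq G, dipath D u v p /\ ~~ odd (size p)) ->
    (chi_DP_star R G <= ((1 + eps) * d / ln d)%:E)%E.
Proof.
(* It will turn out that d q / (1 - tau) = (1 - a) ln d, so the condition on [q] and [tau] reduces
   to b ln d <= d^a. *)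
pose a := (eps / 4) / (1 + eps / 4); pose b := 4 / eps.
have e4 : 0 < 1 + eps / 4 by lra.
have e2 : 0 < 1 + eps / 2 by lra.
have a0 : 0 < a by rewrite !divr_gt0.
have b0 : 0 < b by rewrite divr_gt0.
have L00 : 0 < 4 * b / a ^+ 2.
  by apply: divr_gt0; [apply: mulr_gt0|apply: exprn_gt0].
(* This puts ln d above the threshold of [le_ln_expR]. *)
exists (expR (1 + 4 * b / a ^+ 2)) => d d0d G D oriD acD degD noeven.
have d0 : 0 < d by apply: lt_le_trans d0d; rewrite expR_gt0.
have Ld : 1 + 4 * b / a ^+ 2 <= ln d by rewrite -[leLHS]expRK ler_ln ?posrE ?expR_gt0.
set l := ln d in Ld *.
have l0 : 0 < l by apply: lt_le_trans Ld; rewrite addr_gt0.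
have dE : expR l = d by rewrite lnK.
have bl : b * l <= expR (a * l) by apply: le_ln_expR => //; apply: le_trans Ld; rewrite lerDr.
have ld : l <= d by rewrite -dE; apply: le_trans (expR_ge1Dx l); lra.
(* [eta] is the inverse of the target bound. Replacing [eps] by [eps / 2] in [q] leaves room for
   concentration, and [tau] spends half of what remains: 1 - tau = s (1 + eps / 4). *)
pose s := (1 + eps / 2)^-1; pose q := s * l / d.
pose eta := l / ((1 + eps) * d); pose tau := s * (eps / 4).
have s0 : 0 < s by rewrite invr_gt0.
have s1 : s <= 1 by rewrite invf_le1 //; lra.
have eta0 : 0 < eta by rewrite divr_gt0 // mulr_gt0 //; lra.
have ne4 := lt0r_neq0 e4; have ne2 := lt0r_neq0 e2.
have ned := lt0r_neq0 d0; have nee := lt0r_neq0 eps_gt0.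
have tauE : 1 - tau = s * (1 + eps / 4) by rewrite /tau /s; field; lra.
have etaq : eta < q.
  rewrite /eta /q invfM mulrCA mulrA ltr_pM2r ?invr_gt0 //.
  by rewrite ltr_pM2r // ltf_pV2 ?posrE; lra.
have q1 : q <= 1 by rewrite ler_pdivrMr // mul1r; apply: le_trans ld; rewrite ler_piMl // ltW.
have tau1 : tau < 1 by rewrite -subr_gt0 tauE mulr_gt0.
have qtau : q <= tau * expR (- (d * q / (1 - tau))).
  have -> : - (d * q / (1 - tau)) = a * l + - l.
    rewrite tauE /q /a /s; field; lra.
  rewrite expRD expRN dE /q mulrA ler_pM2r ?invr_gt0 //.
  rewrite /tau -mulrA ler_pM2l //; apply: le_trans (ler_wpM2l _ bl); last lra.
  by have -> : eps / 4 * (b * l) = l by rewrite /b; field.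
have [k k0 colk] := DP_colorable_lt oriD acD degD noeven (ltW eta0) etaq q1 tau1 qtau.
have eta_le : eta <= theta_DP R G k.
  have [_ _] := theta_DP_max R G k0; apply=> //.
  by rewrite (ltW eta0) (le_trans (ltW etaq)).
apply: (@le_trans _ _ ((theta_DP R G k)%:E^-1)%E).
  by apply: ereal_inf_lbound; exists k.
have -> : ((1 + eps) * d / l)%:E = (eta%:E^-1)%E.
  by rewrite inver gt_eqF // invf_div.
by rewrite lee_pV2 ?inE ?lee_fin // ltW // (lt_le_trans eta0).
Qed.
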